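(* Define $$\boldsymbol\xi(\boldsymbol a):=\sum_{j=1}^{2N}\boldsymbol a_j-\lambda\mathbb{J}\sum_{j=1}^{2N}d_j\boldsymbol a_j,\qquad \boldsymbol a=(\boldsymbol a_1,\dots,\boldsymbol a_{2N})\in(\mathbb{T}^2)^{2N}_*.$$ Assume $\boldsymbol a=\boldsymbol a(t)=(\boldsymbol a_1(t),\dots,\boldsymbol a_{2N}(t))^T$ is the solution of $$\dot{\boldsymbol{a}}_j-\lambda d_j\mathbb{J}\dot{\boldsymbol{a}}_j=-\frac1\pi\nabla_{\boldsymbol{a}_j}W(\boldsymbol{a};\boldsymbol{q}(\boldsymbol{a})),\qquad 1\le j\le2N,$$ with initial data $\boldsymbol{a}_j(0)=\boldsymbol{a}_j^0$, where $\boldsymbol a^0=(\boldsymbol a_1^0,\dots,\boldsymbol a_{2N}^0)^T\in(\mathbb{T}^2)^{2N}_*$. Then $\boldsymbol\xi(\boldsymbol a)$ is a first integral of this system, i.e. $$\boldsymbol\xi(\boldsymbol a(t))\equiv\boldsymbol\xi(\boldsymbol a(0))=\boldsymbol\xi(\boldsymbol a^0).$$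
   Context: $\mathbb{T}^2=(\mathbb{R}/\mathbb{Z})^2$ is the unit torus; $N\in\mathbb{N}$; $\lambda\in\mathbb{R}$; $(\mathbb{T}^2)^{2N}_*$ is the set of $2N$-tuples of pairwise distinct points of $\mathbb{T}^2$; $d_1=\dots=d_N=1$, $d_{N+1}=\dots=d_{2N}=-1$; $\mathbb{J}=\begin{pmatrix}0&1\\-1&0\end{pmatrix}$. $F$ solves $\Delta F=2\pi(\delta-1)$ on $\mathbb{T}^2$ (with $\delta$ the Dirac mass at $\boldsymbol 0$) and $\int_{\mathbb{T}^2}F\,d\boldsymbol x=0$. For $\boldsymbol a\in(\mathbb{T}^2)^{2N}_*$ and $\boldsymbol q\in2\pi\sum_{j=1}^{2N}d_j\boldsymbol a_j+2\pi\mathbb{Z}^2$, the renormalized energy is $$W(\boldsymbol a;\boldsymbol q)=-\pi\sum_{1\le j\ne k\le2N}d_jd_kF(\boldsymbol a_j-\boldsymbol a_k)+\tfrac12|\boldsymbol q|^2.$$ In the system, $t\mapsto\boldsymbol q(\boldsymbol a(t))\in\mathbb{R}^2$ is the unique continuous map with $\boldsymbol q(\boldsymbol a(0))=\boldsymbol q_0$ and $\boldsymbol q(\boldsymbol a(t))\in2\pi\sum_{j}d_j\boldsymbol a_j(t)+2\pi\mathbb{Z}^2$, for a given $\boldsymbol q_0\in2\pi\sum_{j}d_j\boldsymbol a_j^0+2\pi\mathbb{Z}^2$. In the gradient the dependence of $\boldsymbol q$ on $\boldsymbol a$ is included (locally $\boldsymbol q=2\pi\sum_kd_k\boldsymbol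 a_k+2\pi\boldsymbol k$ with constant $\boldsymbol k\in\mathbb{Z}^2$), so $$\nabla_{\boldsymbol a_j}W(\boldsymbol a;\boldsymbol q)=2\pi d_j\Bigl(-\sum_{k\ne j}d_k\nabla F(\boldsymbol a_j-\boldsymbol a_k)+\boldsymbol q\Bigr).$$ *)

(* Defs.v *)
From HB Require Import structures.
From mathcomp Require Import all_boot all_order all_algebra.
From mathcomp Require Import generic_quotient ring_quotient archimedean.
From mathcomp Require Import all_classical all_reals all_analysis.

Set Implicit Arguments.
Unset Strict Implicit.
Unset Printing Implicit Defensive.

Import Order.TTheory GRing.Theory Num.Theory.
Import numFieldNormedType.Exports.

Local Open Scope classical_set_scope.
Local Open Scope ring_scope.

Notation R2 R := (R * R)%type (only parsing).

Section Torus.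
Variable R : realType.
Local Notation R2 := (R2 R).

Definition Z2 : {pred R2} :=
  [pred z : R2 | (z.1 \is a Num.int) && (z.2 \is a Num.int)].

Fact Z2_zmod_closed : zmod_closed Z2.
Proof.
split=> [|x y /andP[x1 x2] /andP[y1 y2]]; first by rewrite inE /= !rpred0.
by rewrite inE /= !rpredB.
Qed.
HB.instance Definition _ := GRing.isZmodClosed.Build R2 Z2 Z2_zmod_closed.

Definition torus : Type := quotient_topology {ideal_quot Z2}.
HB.instance Definition _ := Topological.on torus.
HB.instance Definition _ := GRing.isZmodule.Build torus
  (@Quotient.addqA _ Z2) (@Quotient.addqC _ Z2)
  (@Quotient.add0q _ Z2) (@Quotient.addNq _ Z2).

Definition tpi : R2 -> torus := \pi_({ideal_quot Z2})%qT.

Definition e1 : R2 := (1, 0).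
Definition e2 : R2 := (0, 1).

Definition J (v : R2) : R2 := (v.2, - v.1).

Definition sqnorm (v : R2) : R := v.1 ^+ 2 + v.2 ^+ 2.

(* The tangent space of the torus at p is R^2, through h |-> p + tpi h. *)
Definition tderivable (f : torus -> R) (p : torus) (v : R2) : Prop :=
  derivable (fun h : R2 => f (p + tpi h)) 0 v.

Definition tderive (v : R2) (f : torus -> R) (p : torus) : R :=
  'D_v (fun h : R2 => f (p + tpi h)) 0.

Definition laplacian (f : torus -> R) (p : torus) : R :=
  tderive e1 (tderive e1 f) p + tderive e2 (tderive e2 f) p.

(* f is of class C^k at every point of A; only meaningful for A open *)
Fixpoint class_C (k : nat) (A : set torus) (f : torus -> R) : Prop :=
  (forall p, A p -> {for p, continuous f}) /\
  match k with
  | 0%N => True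
  | k'.+1 => forall v : R2,
      (forall p, A p -> tderivable f p v) /\ class_C k' A (tderive v f)
  end.

Definition smooth (f : torus -> R) : Prop := forall k, class_C k setT f.

Definition square_measure :=
  ((@lebesgue_measure R) \x (@lebesgue_measure R))%E.

Definition unit_square : set R2 := `[0, 1]%classic `*` `[0, 1]%classic.

Definition tintegrable (f : torus -> R) : Prop :=
  square_measure.-integrable unit_square (fun z => (f (tpi z))%:E).

Definition tintegral (f : torus -> R) : R :=
  Rintegral square_measure unit_square (fun z => f (tpi z)).

(* The equation Delta F = 2 pi (delta - 1) holds in the sense of distributions.
   This determines F almost everywhere; the second condition selects the
   classical representative off the singularity, which exists by elliptic
   regularity.  The value F 0 is irrelevant. *)
Definition is_green (F : torus -> R) : Prop :=
  [/\ tintegrable F,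
      class_C 1 (~` [set 0]) F,
      forall phi : torus -> R, smooth phi ->
        tintegral (fun p => F p * laplacian phi p)
        = 2 * pi * (phi 0 - tintegral phi)
    & tintegral F = 0].

End Torus.

Section Vortices.
Variables (R : realType) (N : nat).
Local Notation R2 := (R2 R).
Local Notation torus := (torus R).

Definition deg (j : 'I_(2 * N)) : int := if (j < N)%N then 1 else -1.

Definition admissible_phase (a : 'I_(2 * N) -> torus) (q : R2) : Prop :=
  tpi ((2 * pi)^-1 *: q) = \sum_j a j *~ deg j.

Definition energy (F : torus -> R) (a : 'I_(2 * N) -> torus) (q : R2) : R :=
  - pi * (\sum_j \sum_(k | k != j) (deg j)%:~R * (deg k)%:~R * F (a j - a k))
  + 2^-1 * sqnorm q.

(* The energy after the j-th point is displaced by h, with q following the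
   locally continuous branch of 2 pi sum_k d_k a_k + 2 pi Z^2 through (a, q). *)
Definition energy_displaced (F : torus -> R) (a : 'I_(2 * N) -> torus)
    (q : R2) (j : 'I_(2 * N)) (h : R2) : R :=
  energy F [eta a with j |-> a j + tpi h] (q + (2 * pi * (deg j)%:~R) *: h).

Definition grad_energy (F : torus -> R) (a : 'I_(2 * N) -> torus)
    (q : R2) (j : 'I_(2 * N)) : R2 :=
  ('D_(e1 R) (energy_displaced F a q j) 0,
   'D_(e2 R) (energy_displaced F a q j) 0).

(* The velocity of a curve in the torus, read in a local lift to R^2. *)
Definition has_velocity (c : R -> torus) (t : R) (v : R2) : Prop :=
  exists2 y : R -> R2, (\forall s \near t, tpi (y s) = c s)
                       & is_derive t (1 : R) y v.

(* The equations are required in the interior of the interval of existence I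
   only; at an end point of I, such as the initial time, continuity suffices. *)
Definition is_solution (lambda : R) (F : torus -> R) (I : interval R)
    (a0 : 'I_(2 * N) -> torus) (q0 : R2)
    (a : R -> 'I_(2 * N) -> torus) (q : R -> R2) : Prop :=
  [/\ forall j, {within [set` I], continuous (fun t => a t j)},
      forall t, t \in I -> injective (a t),
      {within [set` I], continuous q} /\
        (forall t, t \in I -> admissible_phase (a t) (q t)),
      a 0 = a0 /\ q 0 = q0
    & forall t, [set` I]° t -> forall j, exists2 v : R2,
        has_velocity (fun s => a s j) t v
        & v - (lambda * (deg j)%:~R) *: J v
          = - pi^-1 *: grad_energy F (a t) (q t) j].

(* Unless lambda is an integer, J scaled by lambda does not act on the torus:
   xi is a function of representatives in R^2, and along a curve it is
   evaluated on a continuous lift. *)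
Definition xi (lambda : R) (x : 'I_(2 * N) -> R2) : R2 :=
  \sum_j x j - lambda *: J (\sum_j x j *~ deg j).

Definition is_lift (I : interval R) (a : R -> 'I_(2 * N) -> torus)
    (x : R -> 'I_(2 * N) -> R2) : Prop :=
  forall j, {within [set` I], continuous (fun t => x t j)} /\
            (forall t, t \in I -> tpi (x t j) = a t j).

End Vortices.

(* Main.v *)
Require Import Defs.
From mathcomp Require Import all_boot all_order all_algebra.
From mathcomp Require Import generic_quotient ring_quotient archimedean.
From mathcomp Require Import all_classical all_reals all_analysis.
From mathcomp Require Import ring.

Import Order.TTheory GRing.Theory Num.Theory.
Import numFieldNormedType.Exports.
Local Open Scope classical_set_scope.
Local Open Scope ring_scope.

(** The energy depends on the points only through their differences and through
    [q]; when all points are displaced by the same [h], the differences do not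
    change and [q] changes by [2 pi (sum_j d_j) h = 0].  Hence the gradients of
    [W] with respect to the points add up to zero, and summing the equations
    of motion over [j] says that the derivative of [xi] along a solution is
    zero.

    Three points make this precise.

    The translation invariance is used at the level of first derivatives.
    Displacing the [j]-th point along a line moves the difference
    [a_l - a_k] along the same line with factor [delta_lj - delta_kj]
    ([rel_displacement]), so the derivative of the energy ([denergy]) is an
    explicit sum in which [j] enters only through this factor and through
    [d_j]; both sum to zero over [j] ([sum_grad_energy]).  The Green function is
    differentiated off the origin only, since the points are distinct.

    The velocity in the equation is that of some local lift of the curve, while
    [xi] is evaluated on a given continuous lift.  Two lifts that are continuous
    at [t] differ by an integer vector depending continuously on time, hence by
    a constant near [t] ([lifts_differ_by_cst]), so they have the same
    derivative ([is_derive_lift]).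

    The equation holds in the interior of the interval only; continuity on the
    whole interval and the mean value theorem, applied to each coordinate,
    extend the conservation to the end points ([derive0_cst_itv_R2]). *)

(** * Derivatives and constancy on intervals *)

Section Derivatives.
Context {R : realType}.

Lemma is_derive_cvgP {V W : normedModType R} (f : V -> W) x v df :
  is_derive x v f df <->
  h^-1 *: (f (h *: v + x) - f x) @[h --> (0 : R)^'] --> df.
Proof.
split=> [[fx <-]|fx]; first exact: fx.
by apply: DeriveDef; [apply/cvg_ex; exists df | apply: cvg_lim].
Qed.

(** This reduces directional derivatives to functions of one real variable, for
    which chain rule and product rule are available. *)
Lemma is_derive_lineP {V W : normedModType R} (f : V -> W) x v df :
  is_derive x v f df <-> is_derive (0 : R) 1 (fun r => f (r *: v + x)) df.
Proof.
rewrite !is_derive_cvgP.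
suff -> : (fun h : R => h^-1 *: (f ((h *: 1 + 0 : R) *: v + x) - f (0 *: v + x)))
    = (fun h => h^-1 *: (f (h *: v + x) - f x)) by [].
by apply/funext => h; rewrite addr0 scale0r add0r [h *: _]mulr1.
Qed.

Lemma is_derive_linear {V W U : normedModType R} (L : W -> U) (f : V -> W)
    x v df :
    linear L -> continuous L -> is_derive x v f df ->
  is_derive x v (fun y => L (f y)) (L df).
Proof.
move=> Ll Lc; rewrite !is_derive_cvgP => fx.
have LZ k w : L (k *: w) = k *: L w.
  have L0 : L 0 = 0.
    by have := Ll (-1) 0 0; rewrite scaler0 addr0 scaleN1r addNr.
  by rewrite -[k *: w]addr0 Ll L0 addr0.
have LB u w : L (u - w) = L u - L w.
  by rewrite addrC -scaleN1r Ll scaleN1r addrC.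
under eq_fun do rewrite -LB -LZ.
exact: (cvg_comp _ L fx (Lc df)).
Qed.

Lemma is_derive_sum_cond {V W : normedModType R} (n : nat) (P : pred 'I_n)
    (f : 'I_n -> V -> W) x v (df : 'I_n -> W) :
    (forall i, P i -> is_derive x v (f i) (df i)) ->
  is_derive x v (fun y => \sum_(i | P i) f i y) (\sum_(i | P i) df i).
Proof.
move=> fP; rewrite big_mkcond.
have -> : (fun y => \sum_(i | P i) f i y)
    = \sum_(i < n) (if P i then f i else cst 0).
  apply/funext => y; rewrite fct_sumE big_mkcond.
  by apply: eq_bigr => i _; case: ifP.
apply: is_derive_sum => i; case: ifPn => Pi; [exact: fP | exact: is_derive_cst].
Qed.

(** By the mean value theorem; the derivative is prescribed in the interior
    only, so that the end points of [I] are reached by continuity. *)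
Lemma derive0_cst_itv (g : R -> R) (I : interval R) :
    {within [set` I], continuous g} ->
    (forall s, [set` I]° s -> is_derive s 1 g 0) ->
  {in I &, forall s t, g s = g t}.
Proof.
move=> gc dg s t; wlog st : s t / s < t => [H|] sI tI.
  have [st|ts|->//] := ltgtP s t; first exact: H.
  by rewrite (H t s).
have sub : `[s, t]%classic `<=` [set` I].
  by move=> r /= rst; apply: (interval_is_interval sI tI).
have [||c _] := @MVT _ g (cst 0) s t st.
- move=> r rst; apply: dg; suff : `[s, t]%classic° r by apply: interiorS.
  by rewrite interior_itv.
- exact: continuous_subspaceW gc.
by rewrite mul0r => /subr0_eq.
Qed.

Lemma derive0_cst_itv_R2 (g : R -> R2 R) (I : interval R) :
    {within [set` I], continuous g} ->
    (forall s, [set` I]° s -> is_derive s 1 g 0) ->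
  {in I &, forall s t, g s = g t}.
Proof.
move=> gc dg s t sI tI.
(* The mean value theorem is about real functions: apply it to coordinates. *)
suff H (p : R2 R -> R) : linear p -> continuous p -> p (g s) = p (g t).
  have H1 := H fst (fun _ _ _ => erefl) (fun _ => cvg_fst).
  have H2 := H snd (fun _ _ _ => erefl) (fun _ => cvg_snd).
  by rewrite [g s]surjective_pairing [g t]surjective_pairing H1 H2.
move=> pl pc; apply: (@derive0_cst_itv (p \o g) I) => // [r|r rI].
  exact: (cvg_comp _ p (gc r) (pc _)).
have p0 : p 0 = 0 by have := pl (-1) 0 0; rewrite scaler0 addr0 scaleN1r addNr.
by rewrite -p0; apply: is_derive_linear => //; exact: dg.
Qed.

End Derivatives.

(** * Lifts of curves in the torus *)

Section Lifts.
Context {R : realType}.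

Lemma tpiD : {morph @tpi R : u w / u + w}.
Proof. by move=> u w; exact: (@Quotient.pi_add _ (@Z2 R)). Qed.

Lemma tpiN : {morph @tpi R : u / - u}.
Proof. by move=> u; exact: (@Quotient.pi_opp _ (@Z2 R)). Qed.

Lemma tpi0 : @tpi R 0 = 0.
Proof. by rewrite -(subrr 0) tpiD tpiN subrr. Qed.

Lemma tpi_eq_int (u w : R2 R) : tpi u = tpi w ->
  ((u - w).1 \is a Num.int) /\ ((u - w).2 \is a Num.int).
Proof.
move=> e; apply/andP; change (u - w \in @Z2 R).
by rewrite Quotient.idealrBE; apply/eqP.
Qed.

(** Distinct integers are at distance at least 1. *)
Lemma int_continuous_locally_cst (f : R -> R) t :
    {for t, continuous f} -> (\forall s \near t, f s \is a Num.int) ->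
  \forall s \near t, f s = f t.
Proof.
move=> fc fint; have tint := nbhs_singleton fint.
have /cvgr_dist_lt/(_ _ ltr01) fd := fc.
near=> s; apply/eqP; rewrite -subr_eq0; apply: contraT => neq.
have : 1 <= `|f s - f t|.
  by apply: norm_intr_ge1 neq; rewrite rpredB//; near: s.
rewrite leNgt distrC => /negP[]; near: s; exact: fd.
Unshelve. all: by end_near. Qed.

Lemma lifts_differ_by_cst (x y : R -> R2 R) t :
    {for t, continuous x} -> {for t, continuous y} ->
    (\forall s \near t, tpi (x s) = tpi (y s)) ->
  \forall s \near t, x s = y s + (x t - y t).
Proof.
move=> xc yc xy; have dc : {for t, continuous (fun s => x s - y s)}.
  exact: cvgB.
have dint : \forall s \near t,
    ((x s - y s).1 \is a Num.int) /\ ((x s - y s).2 \is a Num.int).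
  by apply: filterS xy => s /tpi_eq_int.
have d1 : \forall s \near t, (x s - y s).1 = (x t - y t).1.
  apply: (@int_continuous_locally_cst (fun s => (x s - y s).1)).
    exact: (cvg_comp _ fst dc cvg_fst).
  by apply: filterS dint => s [].
have d2 : \forall s \near t, (x s - y s).2 = (x t - y t).2.
  apply: (@int_continuous_locally_cst (fun s => (x s - y s).2)).
    exact: (cvg_comp _ snd dc cvg_snd).
  by apply: filterS dint => s [].
apply: filterS2 d1 d2 => s e1 e2; rewrite addrC -[LHS](subrK (y s)).
by congr (_ + _); rewrite [LHS]surjective_pairing e1 e2 -surjective_pairing.
Qed.

(** The velocity is defined through some lift [y]; every other continuous lift
    differs from it by a constant near [t]. *)
Lemma is_derive_lift (c : R -> torus R) (x : R -> R2 R) t v :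
    {for t, continuous x} -> (\forall s \near t, tpi (x s) = c s) ->
    has_velocity c t v ->
  is_derive t 1 x v.
Proof.
move=> xc xl [y yl dy].
have yc : {for t, continuous y}.
  by apply: differentiable_continuous; apply/derivable1_diffP; case: dy.
have xy : \forall s \near t, tpi (x s) = tpi (y s).
  by apply: filterS2 xl yl => s -> ->.
have := lifts_differ_by_cst _ _ _ xc yc xy => e.
apply: (@near_eq_is_derive _ _ _ (y + cst (x t - y t))).
  by apply: filterS e => s ->.
by rewrite -[v]addr0; apply: is_deriveD.
Qed.

End Lifts.

(** * Translation invariance of the energy *)

Section Energy.
Context {R : realType}.

(** The factor [c] will be [rel_displacement]: the difference of two points moves
    forwards, backwards or not at all when one point is displaced. *)
Lemma is_derive_torus_line (F : torus R -> R) p (v : R2 R) (c : R) :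
    tderivable F p v ->
  is_derive (0 : R) 1 (fun r => F (p + tpi (c *: (r *: v)))) (c * tderive v F p).
Proof.
move=> dF; have /is_derive_lineP dl :
  is_derive (0 : R2 R) v (fun h => F (p + tpi h)) (tderive v F p) by [].
have -> : (fun r => F (p + tpi (c *: (r *: v))))
    = (fun r => F (p + tpi (r *: v + 0))) \o (c \*: id).
  by apply/funext => r /=; rewrite addr0 scalerA.
rewrite mulrC; apply: is_derive1_comp.
  by rewrite /= scaler0.
by rewrite -[X in is_derive _ _ _ X]mulr1; apply: is_deriveZ.
Qed.

Lemma is_derive_sqnorm_line (q v : R2 R) (c : R) :
  is_derive (0 : R) 1 (fun r => sqnorm (q + c *: (r *: v)))
    (2 * c * (q.1 * v.1 + q.2 * v.2)).
Proof.
have line (u w : R) : is_derive (0 : R) 1 (fun r => u + c * (r * w)) (c * w).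
  have -> : (fun r => u + c * (r * w)) = cst u + (c * w) \*: id.
    by apply/funext => r; rewrite [r * w]mulrC mulrA.
  by apply: is_derive_eq; rewrite add0r [_ *: _]mulr1.
have -> : (fun r => sqnorm (q + c *: (r *: v)))
    = (fun r => q.1 + c * (r * v.1)) ^+ 2 + (fun r => q.2 + c * (r * v.2)) ^+ 2.
  by apply/funext.
apply: is_derive_eq; rewrite /GRing.scale /=; ring.
Qed.

Context {N : nat}.
Implicit Types (a : 'I_(2 * N) -> torus R) (q v : R2 R) (j k l : 'I_(2 * N)).

Definition rel_displacement j l k : R := (l == j)%:R - (k == j)%:R.

Lemma displaced_difference a j l k h :
  [eta a with j |-> a j + tpi h] l - [eta a with j |-> a j + tpi h] k
  = a l - a k + tpi (rel_displacement j l k *: h).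
Proof.
rewrite /rel_displacement /=; case: eqVneq => [->|_]; case: eqVneq => [->|_].
- by rewrite !subrr scale0r tpi0 addr0.
- by rewrite subr0 scale1r addrAC.
- by rewrite sub0r scaleN1r tpiN opprD addrA.
- by rewrite subrr scale0r tpi0 addr0.
Qed.

(** Infinitesimal translation invariance: moving all the points together leaves
    each difference in place. *)
Lemma sum_rel_displacement l k : \sum_j rel_displacement j l k = 0.
Proof.
have one i : \sum_j ((i == j)%:R : R) = 1.
  rewrite (bigD1 i)//= eqxx big1 ?addr0// => j.
  by rewrite eq_sym => /negPf ->.
by rewrite sumrB !one subrr.
Qed.

(** The derivative at 0 of [energy_displaced] in direction [v], computed without
    merging the terms of [(l, k)] and [(k, l)], so that the dependence on [j]
    stays in the factors [rel_displacement j l k] and [deg j]. *)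
Definition denergy F a q v j : R :=
  - pi * (\sum_l \sum_(k | k != l) (deg l)%:~R * (deg k)%:~R
      * (rel_displacement j l k * tderive v F (a l - a k)))
  + 2^-1 * (2 * (2 * pi * (deg j)%:~R) * (q.1 * v.1 + q.2 * v.2)).

Lemma is_derive_energy F a q v j :
    injective a -> (forall p, p != 0 -> tderivable F p v) ->
  is_derive (0 : R2 R) v (energy_displaced F a q j) (denergy F a q v j).
Proof.
move=> ainj dF; apply/is_derive_lineP.
rewrite /energy_displaced /energy /denergy.
apply: is_deriveD.
  apply: (@is_deriveZ _ _ _ _ (- pi)).
  apply: is_derive_sum_cond => l _; apply: is_derive_sum_cond => k kl.
  apply: (@is_deriveZ _ _ _ _ ((deg l)%:~R * (deg k)%:~R)).
  under eq_fun do rewrite displaced_difference addr0.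
  apply: is_derive_torus_line; apply: dF.
  (* distinct vortices: [F] is differentiated off its singularity *)
  by rewrite subr_eq0; apply: contra kl => /eqP/ainj ->.
apply: (@is_deriveZ _ _ _ _ 2^-1).
under eq_fun do rewrite addr0.
exact: is_derive_sqnorm_line.
Qed.

Lemma sum_deg : \sum_(j < 2 * N) ((deg j)%:~R : R) = 0.
Proof.
rewrite (eq_bigr (fun j : 'I_(2 * N) => if (j < N)%N then 1 else -1 : R)).
  rewrite -(big_mkord xpredT (fun i => if (i < N)%N then 1 else -1 : R)).
  rewrite mul2n -addnn (big_cat_nat (n := N)) ?leq_addr//=.
  rewrite (eq_big_nat _ _ (F2 := fun=> 1)) => [|i /andP[_ ->]//].
  rewrite [X in _ + X](eq_big_nat _ _ (F2 := fun=> -1)); last first.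
    by move=> i /andP[Ni _]; rewrite ltnNge Ni.
  by rewrite !big_const_nat !iter_addr_0 addnK subn0 mulNrn subrr.
by move=> j _; rewrite /deg; case: ifP.
Qed.

Lemma sum_denergy F a q v : \sum_j denergy F a q v j = 0.
Proof.
rewrite big_split /= -!mulr_sumr -!mulr_suml -!mulr_sumr sum_deg !(mulr0, mul0r).
rewrite addr0 exchange_big big1 ?mulr0// => l _.
rewrite exchange_big big1// => k _.
by rewrite -mulr_sumr -mulr_suml sum_rel_displacement mul0r mulr0.
Qed.

Lemma sum_grad_energy F a q :
    injective a -> (forall p, p != 0 -> forall v, tderivable F p v) ->
  \sum_j grad_energy F a q j = 0.
Proof.
move=> ainj dF.
have -> : \sum_j grad_energy F a q j =
    (\sum_j denergy F a q (e1 R) j, \sum_j denergy F a q (e2 R) j).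
  have dE v j := is_derive_energy F a q v j ainj (fun p p0 => dF p p0 v).
  elim/big_rec3 : _ => // j u w z _ ->; rewrite /grad_energy.
  by rewrite !(@derive_val _ _ _ _ _ _ _ (dE _ j)).
by rewrite !sum_denergy.
Qed.

(** The summand is the linear map that the equation of motion applies to the
    velocity of the [j]-th point. *)
Lemma xi_sum (lambda : R) (x : 'I_(2 * N) -> R2 R) :
  xi lambda x = \sum_j (x j - (lambda * (deg j)%:~R) *: J (x j)).
Proof.
have JD : {morph @J R : u w / u + w}.
  by move=> u w; rewrite /J /= opprD.
have J0 : J 0 = 0 :> R2 R by rewrite /J /= oppr0.
have JZ (m : R) (u : R2 R) : J (m *: u) = m *: J u.
  by rewrite /J /= -scalerN.
rewrite /xi sumrB; congr (_ - _).
rewrite (big_morph _ JD J0) scaler_sumr; apply: eq_bigr => j _.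
by rewrite -scaler_int JZ scalerA.
Qed.

End Energy.

(** * The first integral *)

Theorem theorem5p1 (R : realType) (N : nat) (lambda : R)
    (F : torus R -> R) (hF : is_green F)
    (I : interval R) (hI : 0 \in I)
    (a0 : 'I_(2 * N) -> torus R) (ha0 : injective a0)
    (q0 : R2 R) (hq0 : admissible_phase a0 q0)
    (a : R -> 'I_(2 * N) -> torus R) (q : R -> R2 R)
    (hsol : is_solution lambda F I a0 q0 a q)
    (x0 : 'I_(2 * N) -> R2 R) (hx0 : forall j, tpi (x0 j) = a0 j)
    (x : R -> 'I_(2 * N) -> R2 R) (hx : is_lift I a x) (hx00 : x 0 = x0) :
  forall t : R, t \in I ->
    xi lambda (x t) = xi lambda (x 0) /\ xi lambda (x 0) = xi lambda x0.
Proof.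
move=> t tI; split; last by rewrite hx00.
case: hsol => [_ ainj _ _ hode].
have dF p : p != 0 -> forall v, tderivable F p v.
  by move=> p0 v; case: hF => [_ [_ /(_ v)[+ _]] _ _]; apply; apply/eqP.
have Llin (c : R) : linear (fun u : R2 R => u - c *: J u).
  move=> k u w; apply/pair_equal_spec; split; rewrite /= /GRing.scale /=; ring.
have Jcont : continuous (@J R).
  move=> u; apply: (@cvg_pair _ _ _ _ (nbhs u.2) (nbhs (- u.1)) _ _ _
    snd (fun w : R2 R => - w.1)).
    exact: cvg_snd.
  by apply: cvgN; exact: cvg_fst.
have Lcont (c : R) : continuous (fun u : R2 R => u - c *: J u).
  move=> u; apply: cvgB; first exact: cvg_id.
  by apply: cvgZl_tmp; exact: Jcont.
have xiE : (fun s => xi lambda (x s))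
    = (fun s => \sum_j (x s j - (lambda * (deg j)%:~R) *: J (x s j))).
  by apply/funext => s; exact: xi_sum.
apply: (@derive0_cst_itv_R2 _ (fun s => xi lambda (x s)) I) => // [|s sI].
  rewrite xiE.
  apply: continuous_big => [|j _ r]; first exact: add_continuous.
  exact: (cvg_comp _ _ ((hx j).1 r) (Lcont _ _)).
rewrite xiE.
have sI' : s \in I := interior_subset sI.
have /choice[v hv] j : exists v, has_velocity (fun r => a r j) s v /\
    v - (lambda * (deg j)%:~R) *: J v = - pi^-1 *: grad_energy F (a s) (q s) j.
  by have [v ? ?] := hode s sI j; exists v.
(* the derivative of xi along the curve is the sum of the left-hand sides *)
apply: (is_derive_eq (f' := \sum_j (v j - (lambda * (deg j)%:~R) *: J (v j))));
  last first.
  rewrite (eq_bigr _ (fun j _ => (hv j).2)) -scaler_sumr.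
  by rewrite sum_grad_energy ?scaler0//; exact: ainj.
apply: (@is_derive_sum_cond _ _ _ _ xpredT
  (fun j r => x r j - (lambda * (deg j)%:~R) *: J (x r j))) => j _.
apply: (@is_derive_linear _ _ _ _ (fun u => u - (lambda * (deg j)%:~R) *: J u)
  (fun r => x r j)) => //.
have [xc xl] := hx j.
apply: is_derive_lift (hv j).1.
  have := continuous_subspaceW (@interior_subset _ _) xc.
  rewrite continuous_open_subspace; last exact: open_interior.
  by apply; rewrite inE.
by apply: filterS sI => r rI; exact: xl.
Qed.
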